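(* For every $\text{LDL}_{cp}$ formula $\varphi$ there is an alternating Büchi automaton $\mathfrak{A}_\varphi$ over the alphabet $2^{P'}$ whose number of states is linear in $|\varphi|$ and with $L(\mathfrak{A}_\varphi)=\{w\in(2^{P'})^\omega\mid w\models\varphi\}$.
   Context: Let $P$ be a finite set of propositions, $p\notin P$ fresh, and $P'=P\cup\{p\}$. For $w\in(2^{P'})^\omega$, a position $n$ is a changepoint if $n=0$ or the truth value of $p$ differs at positions $n-1$ and $n$. $\text{LDL}_{cp}$ formulas and regular expressions over $P'$: $\varphi ::= q \mid \neg q \mid \varphi\wedge\varphi\mid\varphi\vee\varphi\mid\langle r\rangle\varphi\mid[r]\varphi\mid\langle r\rangle_{cp}\varphi\mid[r]_{cp}\varphi$ and $r::=\phi\mid\varphi?\mid r+r\mid r\,;r\mid r^*$, with $q\in P'$ and $\phi$ a propositional formula over $P'$. Semantics on $w=w_0w_1\cdots$ at position $n$: $q$ iff $q\in w_n$; $\neg q$ iff $q\notin w_n$; $\wedge,\vee$ as usual; $(w,n)\models\langle r\rangle\psi$ iff there is $j\in\mathbb{N}$ with $(n,n+j)\in\mathcal{R}(r,w)$ and $(w,n+j)\models\psi$; $[r]\psi$ iff all such $j$ satisfy $(w,n+j)\models\psi$; $\langle r\rangle_{cp}\psi$ iff there is $j$ with $(n,n+j)\in\mathcal{R}(r,w)$, at most one of the positions $n,\dots,n+j-1$ is a changepoint, and $(w,n+j)\models\psi$; $[r]_{cp}\psi$ iff every such $j$ (with $(n,n+j)\in\mathcal{R}(r,w)$ and at most one changepoint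 among $n,\dots,n+j-1$) satisfies $(w,n+j)\models\psi$. Here $\mathcal{R}(\phi,w)=\{(n,n+1)\mid w_n\models\phi\}$, $\mathcal{R}(\theta?,w)=\{(n,n)\mid(w,n)\models\theta\}$, $+$ is union, $;$ relational composition, $^*$ reflexive-transitive closure; $w\models\varphi$ means $(w,0)\models\varphi$. The size $|\varphi|$ is the number of subformulas (including those in tests) plus the total length of regular expressions occurring in $\varphi$. An alternating Büchi automaton $(Q,\Sigma,q_0,\delta,F)$ has finite state set $Q$, initial state $q_0$, transition function $\delta:Q\times\Sigma\to\mathcal{B}^+(Q)$ (positive Boolean combinations over $Q$, including true and false), and accepting set $F\subseteq Q$; a run on $w\in\Sigma^\omega$ is a directed graph with vertices in $Q\times\mathbb{N}$, edges only from level $n$ to level $n+1$, containing $(q_0,0)$, such that for every vertex $(q,n)$ the set of $Q$-projections of its successors satisfies $\delta(q,w_n)$; it is accepting if every infinite path visits $F$ infinitely often; $L(\mathfrak{A})$ is the set of words with an accepting run. *)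

(* Defs.v *)
From HB Require Import structures.
From mathcomp Require Import all_boot.
From Stdlib Require Import Relations.Relation_Operators.

Set Implicit Arguments.
Unset Strict Implicit.
Unset Printing Implicit Defensive.

(* P' = P with a fresh proposition p is [option P]: p is [None], and q in P is
   [Some q]. *)

Definition word (P : finType) : Type := nat -> {set option P}.

Inductive prop (P : finType) : Type :=
| PTrue
| PFalse
| PVar of option P
| PNot of prop P
| PAnd of prop P & prop P
| POr of prop P & prop P.

Arguments PTrue {P}.
Arguments PFalse {P}.

Fixpoint psat (P : finType) (a : {set option P}) (f : prop P) : bool :=
  match f with
  | PTrue => true
  | PFalse => false
  | PVar q => q \in a
  | PNot f => ~~ psat a f
  | PAnd f g => psat a f && psat a g
  | POr f g => psat a f || psat a g
  end.

Inductive form (P : finType) : Type :=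
| Var of option P
| NVar of option P
| And of form P & form P
| Or of form P & form P
| Dia of rexp P & form P
| Box of rexp P & form P
| DiaCp of rexp P & form P
| BoxCp of rexp P & form P
with rexp (P : finType) : Type :=
| Letter of prop P
| Test of form P
| Alt of rexp P & rexp P
| Seq of rexp P & rexp P
| Star of rexp P.

Scheme form_rexp_ind := Induction for form Sort Prop
  with rexp_form_ind := Induction for rexp Sort Prop.
Combined Scheme form_rexp_mutind from form_rexp_ind, rexp_form_ind.

Lemma prop_eq_dec (P : finType) (f g : prop P) : {f = g} + {f <> g}.
Proof. decide equality; exact: eq_comparable. Defined.

Fixpoint form_eq_dec (P : finType) (f g : form P) {struct f} :
  {f = g} + {f <> g}
with rexp_eq_dec (P : finType) (r s : rexp P) {struct r} : {r = s} + {r <> s}.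
Proof.
- by decide equality; exact: eq_comparable.
- by decide equality; exact: prop_eq_dec.
Defined.

HB.instance Definition _ (P : finType) :=
  hasDecEq.Build (form P) (compareP (@form_eq_dec P)).
HB.instance Definition _ (P : finType) :=
  hasDecEq.Build (rexp P) (compareP (@rexp_eq_dec P)).

Definition changepoint (P : finType) (w : word P) (n : nat) : bool :=
  if n is m.+1 then (None \in w m) != (None \in w n) else true.

Definition at_most_one_cp (P : finType) (w : word P) (n j : nat) : bool :=
  count (changepoint w) (iota n j) <= 1.

Fixpoint sat (P : finType) (w : word P) (f : form P) (n : nat) {struct f} :
    Prop :=
  match f with
  | Var q => q \in w n
  | NVar q => q \notin w n
  | And f g => sat w f n /\ sat w g n
  | Or f g => sat w f n \/ sat w g n
  | Dia r f => exists j, rel_of w r n (n + j) /\ sat w f (n + j)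
  | Box r f => forall j, rel_of w r n (n + j) -> sat w f (n + j)
  | DiaCp r f =>
      exists j, [/\ rel_of w r n (n + j), at_most_one_cp w n j
                  & sat w f (n + j)]
  | BoxCp r f =>
      forall j, rel_of w r n (n + j) -> at_most_one_cp w n j -> sat w f (n + j)
  end
with rel_of (P : finType) (w : word P) (r : rexp P) (n m : nat) {struct r} :
    Prop :=
  match r with
  | Letter a => psat (w n) a /\ m = n.+1
  | Test f => m = n /\ sat w f n
  | Alt r s => rel_of w r n m \/ rel_of w s n m
  | Seq r s => exists k, rel_of w r n k /\ rel_of w s k m
  | Star r => clos_refl_trans nat (rel_of w r) n m
  end.

Definition models (P : finType) (w : word P) (f : form P) : Prop := sat w f 0.

(* Occurrences of subformulas, with repetitions. *)
Fixpoint subforms (P : finType) (f : form P) : seq (form P) :=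
  f :: match f with
       | Var _ | NVar _ => [::]
       | And g h | Or g h => subforms g ++ subforms h
       | Dia r g | Box r g | DiaCp r g | BoxCp r g =>
           test_subforms r ++ subforms g
       end
with test_subforms (P : finType) (r : rexp P) : seq (form P) :=
  match r with
  | Letter _ => [::]
  | Test f => subforms f
  | Alt r s | Seq r s => test_subforms r ++ test_subforms s
  | Star r => test_subforms r
  end.

(* Propositional formulas and tests are single symbols; the formula inside a
   test contributes to [fsize] through [subforms]. *)
Fixpoint rlength (P : finType) (r : rexp P) : nat :=
  match r with
  | Letter _ | Test _ => 1
  | Alt r s | Seq r s => (rlength r + rlength s).+1
  | Star r => (rlength r).+1
  end.

Definition head_rlength (P : finType) (f : form P) : nat :=
  match f with
  | Dia r _ | Box r _ | DiaCp r _ | BoxCp r _ => rlength r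
  | _ => 0
  end.

(* Subformulas form a set, hence [undup]; regular expressions, each the head of
   a modal subformula, are counted once per occurrence. *)
Definition fsize (P : finType) (f : form P) : nat :=
  size (undup (subforms f)) + \sum_(g <- subforms f) head_rlength g.

Inductive pbool (Q : Type) : Type :=
| BTrue
| BFalse
| BAtom of Q
| BAnd of pbool Q & pbool Q
| BOr of pbool Q & pbool Q.

Arguments BTrue {Q}.
Arguments BFalse {Q}.

Fixpoint bsat (Q : Type) (X : Q -> Prop) (b : pbool Q) : Prop :=
  match b with
  | BTrue => True
  | BFalse => False
  | BAtom q => X q
  | BAnd b c => bsat X b /\ bsat X c
  | BOr b c => bsat X b \/ bsat X c
  end.

Record aba (Sigma : Type) : Type := Aba {
  state : finType;
  init : state;
  delta : state -> Sigma -> pbool state;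
  final : {set state}
}.

Definition is_run (Sigma : Type) (A : aba Sigma) (w : nat -> Sigma)
    (V : state A * nat -> Prop)
    (E : state A * nat -> state A * nat -> Prop) : Prop :=
  [/\ forall u v, E u v -> [/\ V u, V v & v.2 = u.2.+1],
      V (init A, 0)
    & forall q n, V (q, n) ->
        bsat (fun q' => E (q, n) (q', n.+1)) (delta q (w n))].

Definition accepting_run (Sigma : Type) (A : aba Sigma)
    (E : state A * nat -> state A * nat -> Prop) : Prop :=
  forall pi : nat -> state A * nat, (forall i, E (pi i) (pi i.+1)) ->
  forall m, exists2 i, m <= i & (pi i).1 \in final A.

Definition lang (Sigma : Type) (A : aba Sigma) (w : nat -> Sigma) : Prop :=
  exists (V : state A * nat -> Prop) (E : state A * nat -> state A * nat -> Prop),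
    is_run w V E /\ accepting_run E.

(* Main.v *)
Require Import Defs.
From HB Require Import structures.
From mathcomp Require Import all_boot zify.
From Stdlib Require Import Relations.Relation_Operators ClassicalEpsilon.

Set Implicit Arguments.
Unset Strict Implicit.
Unset Printing Implicit Defensive.

(** The automaton reads a regular expression through its partial derivatives:
    besides the initial state there is one state per letter occurring in a
    modality [<r>h], for the continuation [k] that remains to be read before
    [h], times a constant amount of data: the value of [p] at the previous
    position, the number of changepoints still allowed, and two signs.
    Boolean connectives, tests and empty matches are resolved inside the
    transition function and cost no states, and a negative state carries the
    dual transition of the positive one, which handles boxes and negated tests.

    A positive state is a least fixpoint: it holds iff some witness length [j]
    exists, and each step either decreases [j] or moves to a strictly smaller
    formula. So positive states are rejecting, negative ones accepting, and the
    automaton is weak: an infinite path eventually has constant level and sign. *)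

(** * Positive Boolean combinations, their atoms and their duals *)

Fixpoint ball (Q : Type) (Y : Q -> Prop) (b : pbool Q) : Prop :=
  match b with
  | BTrue | BFalse => True
  | BAtom q => Y q
  | BAnd b c | BOr b c => ball Y b /\ ball Y c
  end.

Fixpoint bmap (Q R : Type) (f : Q -> R) (b : pbool Q) : pbool R :=
  match b with
  | BTrue => BTrue
  | BFalse => BFalse
  | BAtom q => BAtom (f q)
  | BAnd b c => BAnd (bmap f b) (bmap f c)
  | BOr b c => BOr (bmap f b) (bmap f c)
  end.

(** De Morgan negation within positive combinations: an atom is negated by flipping its sign. *)
Fixpoint bdual (Q : Type) (b : pbool (bool * Q)) : pbool (bool * Q) :=
  match b with
  | BTrue => BFalse
  | BFalse => BTrue
  | BAtom q => BAtom (~~ q.1, q.2)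
  | BAnd b c => BOr (bdual b) (bdual c)
  | BOr b c => BAnd (bdual b) (bdual c)
  end.

Lemma bsat_map (Q R : Type) (f : Q -> R) (X : R -> Prop) b :
  bsat X (bmap f b) <-> bsat (fun q => X (f q)) b.
Proof. by elim: b => //= b [? ?] c [? ?]; split; intuition. Qed.

Lemma ball_map (Q R : Type) (f : Q -> R) (Y : R -> Prop) b :
  ball Y (bmap f b) <-> ball (fun q => Y (f q)) b.
Proof. by elim: b => //= b [? ?] c [? ?]; split; intuition. Qed.

Lemma ball_imp (Q : Type) (Y Z : Q -> Prop) b :
  (forall q, Y q -> Z q) -> ball Y b -> ball Z b.
Proof. by move=> YZ; elim: b => //= b IHb c IHc; intuition. Qed.

Lemma ball_and (Q : Type) (Y Z : Q -> Prop) b :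
  ball Y b -> ball Z b -> ball (fun q => Y q /\ Z q) b.
Proof. by elim: b => //= b IHb c IHc; intuition. Qed.

Lemma bsat_imp (Q : Type) (X Y : Q -> Prop) b :
  (forall q, X q -> Y q) -> bsat X b -> bsat Y b.
Proof. by move=> XY; elim: b => //= b IHb c IHc; intuition. Qed.

(** [ball] covers the atoms of both disjuncts, so its property is available whichever disjunct is
    satisfied. *)
Lemma bsat_ball (Q : Type) (X Y : Q -> Prop) b :
  ball Y b -> bsat X b -> bsat (fun q => X q /\ Y q) b.
Proof. by elim: b => //= b IHb c IHc; intuition. Qed.

Lemma ball_dual (Q : Type) (Y : bool * Q -> Prop) b :
  ball Y (bdual b) <-> ball (fun p => Y (~~ p.1, p.2)) b.
Proof. by elim: b => //= b [? ?] c [? ?]; split; intuition. Qed.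

(** Contrapositive of monotonicity; it picks a failing successor of a failing state. *)
Lemma bsat_witness (Q : Type) (X Y : Q -> Prop) b :
  bsat X b -> ~ bsat Y b -> exists q, X q /\ ~ Y q.
Proof.
elim: b => //= [q|b IHb c IHc|b IHb c IHc]; first by exists q.
- move=> [Xb Xc] nY; case: (classic (bsat Y b)) => Yb; last exact: IHb.
  by apply: IHc => // Yc; apply: nY.
- by move=> [Xb|Xc] nY; [apply: IHb | apply: IHc] => // ?; apply: nY; auto.
Qed.

(** A choice for [b] and a choice for its dual meet in an atom, as two opposing strategies in a
    finite game do. *)
Lemma bsat_dual_conflict (Q : Type) (X Y : bool * Q -> Prop) b :
  bsat X b -> bsat Y (bdual b) -> exists q, X q /\ Y (~~ q.1, q.2).
Proof.
by elim: b => //= [q|b IHb c IHc|b IHb c IHc]; first (by exists q); intuition.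
Qed.

Lemma bsat_dual (Q : Type) (X : bool * Q -> Prop) b :
  (forall c q, X (~~ c, q) <-> ~ X (c, q)) ->
  bsat X (bdual b) <-> ~ bsat X b.
Proof.
move=> XN; elim: b => //= [|[c q]|b IHb c IHc|b IHb c IHc].
- by split=> // _ [].
- exact: XN.
- rewrite IHb IHc; split; first by case=> H [].
  by move=> H; apply: not_and_or.
- by rewrite IHb IHc; split; [case=> H1 H2 [] | move=> H; split=> ?; apply: H; auto].
Qed.

(** * Least witnesses and dependent choice *)

Lemma ex_minimal (R : nat -> Prop) :
  (exists j, R j) -> exists j, R j /\ forall i, R i -> j <= i.
Proof.
move=> [j Rj]; elim/ltn_ind: j Rj => j IH Rj.
case: (classic (exists2 i, i < j & R i)) => [[i ij Ri]|H]; first exact: IH ij Ri.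
exists j; split=> // i Ri; rewrite leqNgt; apply/negP => ij; apply: H.
by exists i.
Qed.

Lemma dependent_choice (U : Type) (B : U -> Prop) (E : U -> U -> Prop) u0 :
  B u0 -> (forall u, B u -> exists2 v, E u v & B v) ->
  exists pi : nat -> U, forall i, E (pi i) (pi i.+1) /\ B (pi i).
Proof.
move=> B0 next.
have next' (u : {u | B u}) : {v : {v | B v} | E (sval u) (sval v)}.
  apply: constructive_indefinite_description.
  by case: u => u Bu; have [v uv Bv] := next u Bu; exists (exist _ v Bv).
pose path i := iter i (fun u => sval (next' u)) (exist _ u0 B0).
exists (fun i => sval (path i)) => i; split; last exact: svalP.
exact: (svalP (next' (path i))).
Qed.

(** * Weak automata given by signed transitions *)

Definition signed_aba (Sigma : Type) (Q : finType) (q0 : Q)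
    (step : Q -> Sigma -> pbool (bool * Q)) : aba Sigma :=
  @Aba Sigma (bool * Q)%type (true, q0)
    (fun s a => if s.1 then step s.2 a else bdual (step s.2 a))
    [set s | ~~ s.1].

Definition signed (Q : Type) (T : Q -> nat -> nat -> Prop) (n : nat)
    (s : bool * Q) : Prop :=
  if s.1 then exists j, T s.2 n j else ~ exists j, T s.2 n j.

Lemma signedN (Q : Type) (T : Q -> nat -> nat -> Prop) n c q :
  signed T n (~~ c, q) <-> ~ signed T n (c, q).
Proof. by case: c; rewrite /signed //=; split; [auto | apply: NNPP]. Qed.

(* [T q n j]: the positive state [q] is witnessed at position [n] in [j] steps. *)
Section SignedLang.

Variables (Sigma : Type) (Q : finType) (q0 : Q).
Variables (step : Q -> Sigma -> pbool (bool * Q)) (lvl : Q -> nat).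
Variables (w : nat -> Sigma) (compat : Q -> nat -> Prop).
Variable (T : Q -> nat -> nat -> Prop).

Hypothesis compat0 : compat q0 0.
(** [compat] ties the data stored in a state to the word read so far. Levels never rise, and a
    successor on the same level keeps the sign; the negative case follows by dualizing. *)
Hypothesis compat_step : forall q n, compat q n ->
  ball (fun s : bool * Q => compat s.2 n.+1 /\
          (lvl s.2 < lvl q \/ s.1 /\ lvl s.2 <= lvl q)) (step q (w n)).
Hypothesis step_complete : forall q n j, compat q n -> T q n j ->
  bsat (fun s : bool * Q => signed T n.+1 s /\
          (lvl s.2 < lvl q \/ s.1 /\ exists2 i, i < j & T s.2 n.+1 i))
    (step q (w n)).
Hypothesis step_sound : forall q n, compat q n ->
  bsat (signed T n.+1) (step q (w n)) -> exists j, T q n j.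

(** Every compatible vertex of an accepting run is true, by induction on its level. If a negative
    vertex had a witness of length [j], the choice made by the run would meet the one given by
    [step_complete]: a lower level contradicts the induction, and the same level yields a negative
    vertex with a shorter witness. False positive vertices are excluded by acceptance. *)
Lemma signed_lang_sound : lang (signed_aba q0 step) w -> exists j, T q0 0 j.
Proof.
move=> [V [E [[EV V0 VE] acc]]].
suff main l q n c : lvl q < l -> compat q n -> V ((c, q), n) -> signed T n (c, q).
  exact: (main _ _ _ true (ltnSn _) compat0 V0).
elim: l q n c => // l IH q n c; rewrite ltnS => ql cq Vq.
have := VE _ _ Vq; case: c Vq => /= Vq; last first.
  move=> Edual [j]; elim/ltn_ind: j q n ql cq Vq Edual => j IHj q n ql cq Vq Edual Tj.
  have [[c q'] /= [[[sg Hl] [cq' Hl2]] Eq']] :=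
    bsat_dual_conflict (bsat_ball (compat_step cq) (step_complete cq Tj)) Edual.
  have [_ Vq' _] := EV _ _ Eq'.
  have Hlow : lvl q' < l -> False.
    by move=> lq'; have /signedN := IH _ _ _ lq' cq' Vq'.
  have [lq'|lq'] := ltnP (lvl q') l; first exact: Hlow.
  have {}Hl : c /\ exists2 i, i < j & T q' n.+1 i.
    by case: Hl => // /leq_trans/(_ ql)/(leq_ltn_trans lq'); rewrite ltnn.
  have {}Hl2 : lvl q' <= lvl q by case: Hl2 => [/ltnW|[]].
  case: Hl => ct [i ij Ti]; case: c ct sg Eq' Vq' => // _ _ Eq' Vq'.
  exact: (IHj i ij q' n.+1 (leq_trans Hl2 ql) cq' Vq' (VE _ _ Vq') Ti).
(* If the positive state failed, failing successors of the same level would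
   form an infinite path avoiding the final states. *)
pose B (u : state (signed_aba q0 step) * nat) :=
  [/\ u.1.1, lvl u.1.2 <= l, compat u.1.2 u.2, V u & ~ exists j, T u.1.2 u.2 j].
apply: NNPP => /= nT.
have /(dependent_choice (E := E)) next : B ((true, q), n) by split.
case: next => [[[c {}q] {}n] [/= ct {}ql {}cq {}Vq {}nT]|pi Hpi].
  case: c ct Vq => // _ Vq.
  have nb : ~ bsat (signed T n.+1) (step q (w n)) by move/(step_sound cq).
  have [[c q'] /= [[Eq' [cq' Hl]] nsg]] :=
    bsat_witness (bsat_ball (compat_step cq) (VE _ _ Vq)) nb.
  have [_ Vq' _] := EV _ _ Eq'.
  have [lq'|lq'] := ltnP (lvl q') l; first by case: nsg; apply: IH.
  have {Hl} [ct le_l] : c /\ lvl q' <= lvl q.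
    by case: Hl => // /leq_trans/(_ ql)/(leq_ltn_trans lq'); rewrite ltnn.
  case: c ct Eq' Vq' nsg => // _ Eq' Vq' nsg.
  by exists ((true, q'), n.+1) => //; split=> //=; apply: leq_trans ql.
have [i _] := acc pi (fun i => (Hpi i).1) 0.
by rewrite inE; case: (Hpi i).2 => ->.
Qed.

Lemma signed_lang_complete : (exists j, T q0 0 j) -> lang (signed_aba q0 step) w.
Proof.
move=> T0.
pose V (u : (bool * Q) * nat) := compat u.1.2 u.2 /\ signed T u.2 u.1.
(* Edges either drop in level, or keep the sign and, at positive vertices, shorten the witness;
   acceptance rests on this. *)
pose R (u v : (bool * Q) * nat) := lvl v.1.2 < lvl u.1.2 \/
  [/\ lvl v.1.2 <= lvl u.1.2, v.1.1 = u.1.1 &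
    u.1.1 -> forall j, T u.1.2 u.2 j -> exists2 i, i < j & T v.1.2 v.2 i].
exists V, (fun u v => [/\ V u, V v, v.2 = u.2.+1 & R u v]); split; first split.
- by move=> u v [].
- by [].
- move=> [c q] n Vq; have [/= cq] := Vq; case: c Vq => Vq /= Tq.
    (* With [j] minimal, a single witness [i < j] of the successor lies below every witness of [q],
       as [R] requires. *)
    have [j [Tj minj]] := ex_minimal Tq.
    have := bsat_ball (compat_step cq) (step_complete cq Tj).
    apply: bsat_imp => -[c q'] /= [[sg H] [cq' Hl]]; split=> //.
    case: H => [?|[ct [i ij Ti]]]; first by left.
    have [lt_l|ge_l] := ltnP (lvl q') (lvl q); [by left | right].
    split=> //=; first by case: Hl => [/ltnW //|[]].
    by move=> _ j' /minj jj'; exists i => //; apply: leq_trans jj'.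
  have Hb : ball (fun s : bool * Q => compat s.2 n.+1 /\
      (lvl s.2 < lvl q \/ ~~ s.1 /\ lvl s.2 <= lvl q)) (bdual (step q (w n))).
    by apply/ball_dual; apply: ball_imp (compat_step cq) => -[[] q'].
  have : bsat (signed T n.+1) (bdual (step q (w n))).
    by apply/(bsat_dual _ (@signedN _ T n.+1)) => /(step_sound cq).
  move=> /(bsat_ball Hb); apply: bsat_imp => -[c q'] /= [sg [cq' Hl]].
  split=> //; case: Hl => [?|[/negbTE ct ?]]; [by left | right].
  by split.
move=> pi Epi m.
(* A path cannot stay positive forever: each positive vertex is followed by a drop in level or a
   shorter witness. *)
suff main l i : m <= i -> lvl (pi i).1.2 < l -> exists2 i, m <= i & ~~ (pi i).1.1.
  have [i mi H] := main _ m (leqnn m) (ltnSn _).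
  by exists i => //; rewrite inE.
elim: l i => // l IH i mi; rewrite ltnS => li.
case E: (pi i).1.1; last by exists i => //; rewrite E.
have [[_]] := Epi i; rewrite /signed E => -[j Tj] _ _ _.
elim/ltn_ind: j i mi li E Tj => j IHj i mi li E Tj.
have [_ _ _ [lt_l|[le_l eqs dec]]] := Epi i.
  by apply: (IH i.+1); [apply: leqW | apply: leq_trans li].
have [i' ij' Ti'] := dec E _ Tj.
apply: (IHj _ ij' i.+1); [exact: leqW|exact: leq_trans li|by rewrite eqs|exact: Ti'].
Qed.

End SignedLang.

(** Passes from a finite state type to configurations in a list closed under [step]. The automaton
    is fixed before [w], on which [compat] and [T] may depend. *)
Lemma signed_lang_seq (Sigma : Type) (X : eqType) (x0 : X) (L : seq X)
    (step : X -> Sigma -> pbool (bool * X)) (lvl : X -> nat) :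
  (forall x a, x \in x0 :: L -> ball (fun s : bool * X => s.2 \in x0 :: L) (step x a)) ->
  (forall x a, ball (fun s : bool * X => lvl s.2 < lvl x \/ s.1 /\ lvl s.2 <= lvl x)
                 (step x a)) ->
  exists A : aba Sigma, #|state A| = 2 * (size L).+1 /\
    forall (w : nat -> Sigma) (compat : X -> nat -> Prop)
           (T : X -> nat -> nat -> Prop),
      compat x0 0 ->
      (forall x n, x \in x0 :: L -> compat x n ->
         ball (fun s : bool * X => compat s.2 n.+1) (step x (w n))) ->
      (forall x n j, compat x n -> T x n j ->
         bsat (fun s : bool * X => signed T n.+1 s /\
                 (lvl s.2 < lvl x \/ s.1 /\ exists2 i, i < j & T s.2 n.+1 i))
           (step x (w n))) ->
      (forall x n, compat x n -> bsat (signed T n.+1) (step x (w n)) ->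
         exists j, T x n j) ->
      lang A w <-> exists j, T x0 0 j.
Proof.
move=> closed descend.
pose Q : finType := 'I_(size L).+1.
pose dec (q : Q) := nth x0 (x0 :: L) q.
(* Repetitions in [L] are harmless: [index] takes the first occurrence, and only [dec (enc x) = x]
   is used. *)
pose enc x : Q := inord (index x (x0 :: L)).
have decL q : dec q \in x0 :: L by apply: mem_nth; exact: ltn_ord.
have encK x : x \in x0 :: L -> dec (enc x) = x.
  by move=> xL; rewrite /dec /enc inordK ?nth_index //; move: xL; rewrite -index_mem.
pose enc_s (s : bool * X) := (s.1, enc s.2).
pose qstep q a := bmap enc_s (step (dec q) a).
exists (signed_aba ord0 qstep); split; first by rewrite card_prod card_bool card_ord.
move=> w compat T c0 cstep complete sound.
pose Tq q := T (dec q).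
have signedE n s : s.2 \in x0 :: L -> signed Tq n (enc_s s) <-> signed T n s.
  by case: s => c x /= /encK e; rewrite /signed /Tq /= e.
have dec0 : dec ord0 = x0 by [].
suff: lang (signed_aba ord0 qstep) w <-> exists j, Tq ord0 0 j by [].
have Hcompat q n : compat (dec q) n ->
  ball (fun s : bool * Q => compat (dec s.2) n.+1 /\
     (lvl (dec s.2) < lvl (dec q) \/ s.1 /\ lvl (dec s.2) <= lvl (dec q)))
    (qstep q (w n)).
  move=> cq; apply/ball_map.
  apply: ball_imp (ball_and (closed _ (w n) (decL q))
    (ball_and (cstep _ _ (decL q) cq) (descend (dec q) (w n)))).
  by move=> s [sL [H1 H2]] /=; rewrite encK.
have Hcomplete q n j : compat (dec q) n -> Tq q n j ->
  bsat (fun s : bool * Q => signed Tq n.+1 s /\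
     (lvl (dec s.2) < lvl (dec q) \/ s.1 /\ exists2 i, i < j & Tq s.2 n.+1 i))
    (qstep q (w n)).
  move=> cq Tj; apply/bsat_map.
  have := bsat_ball (closed _ (w n) (decL q)) (complete _ _ _ cq Tj).
  apply: bsat_imp => s [[H1 H2] sL]; split; first exact/signedE.
  by rewrite /Tq /= encK.
have Hsound q n : compat (dec q) n -> bsat (signed Tq n.+1) (qstep q (w n)) ->
  exists j, Tq q n j.
  move=> cq /bsat_map /(bsat_ball (closed _ (w n) (decL q))) H.
  apply: sound cq _; apply: bsat_imp H => s [H sL]; exact/signedE.
split.
- exact: (signed_lang_sound (lvl := fun q => lvl (dec q))
    (compat := fun q => compat (dec q))).
- exact: (signed_lang_complete (lvl := fun q => lvl (dec q))
    (compat := fun q => compat (dec q))).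
Qed.

(** * Transitions by partial derivatives *)

(* [((bud, pol, c), (k, h))]: match the concatenation [k] within budget [bud]
   ([None]: unrestricted; [Some b]: at most [b] changepoints), then satisfy [h]
   ([pol = true]) or its negation; [c] is the previous value of [p], [None] at
   position 0. *)
Definition config (P : finType) : eqType :=
  ((option bool * bool * option bool) * (seq (rexp P) * form P))%type.

(** [cp] tells whether the consumed letter sits at a changepoint; at position 0, [c = None] differs
    from every [Some], which makes 0 a changepoint. Spending the last unit turns [Some true] into
    [Some false]. *)
Definition next_config (P : finType) (a : {set option P}) (c bud : option bool)
    (pol : bool) (h : form P) (k : seq (rexp P)) : pbool (bool * config P) :=
  let c' := Some (None \in a) in
  let cp := c != c' in
  if cp && (bud == Some false) then BFalse
  else BAtom (true, ((omap (fun b => b && ~~ cp) bud, pol, c'), (k, h))).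

(* [null_step r] is the condition for [r] to match the empty factor;
   [first_step r next k] consumes the current letter with [r] and passes what is
   left of [r], prepended to [k], to [next]. *)
Section Step.

Variables (P : finType) (a : {set option P}) (c : option bool).

(** A box is the negation of a diamond with negated body, hence the polarity [false] and the nested
    [bdual]. An empty match consumes no letter and thus spends no budget. *)
Fixpoint form_step (f : form P) : pbool (bool * config P) :=
  match f with
  | Var q => if q \in a then BTrue else BFalse
  | NVar q => if q \in a then BFalse else BTrue
  | And f g => BAnd (form_step f) (form_step g)
  | Or f g => BOr (form_step f) (form_step g)
  | Dia r g =>
      BOr (first_step r (next_config a c None true g) [::])
          (BAnd (null_step r) (form_step g))
  | Box r g =>
      bdual (BOr (first_step r (next_config a c None false g) [::])
                 (BAnd (null_step r) (bdual (form_step g))))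
  | DiaCp r g =>
      BOr (first_step r (next_config a c (Some true) true g) [::])
          (BAnd (null_step r) (form_step g))
  | BoxCp r g =>
      bdual (BOr (first_step r (next_config a c (Some true) false g) [::])
                 (BAnd (null_step r) (bdual (form_step g))))
  end
with null_step (r : rexp P) : pbool (bool * config P) :=
  match r with
  | Letter _ => BFalse
  | Test f => form_step f
  | Alt r s => BOr (null_step r) (null_step s)
  | Seq r s => BAnd (null_step r) (null_step s)
  | Star r => BTrue
  end
with first_step (r : rexp P) (next : seq (rexp P) -> pbool (bool * config P))
    (k : seq (rexp P)) : pbool (bool * config P) :=
  match r with
  | Letter b => if psat a b then next k else BFalse
  | Test _ => BFalse
  | Alt r s => BOr (first_step r next k) (first_step s next k)
  | Seq r s => BOr (first_step r next (s :: k))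
                   (BAnd (null_step r) (first_step s next k))
  | Star r => first_step r next (Star r :: k)
  end.

Definition list_step (next : seq (rexp P) -> pbool (bool * config P))
    (e : pbool (bool * config P)) : seq (rexp P) -> pbool (bool * config P) :=
  fix loop k :=
  if k is r :: k then BOr (first_step r next k) (BAnd (null_step r) (loop k))
  else e.

Definition signed_step (pol : bool) (h : form P) : pbool (bool * config P) :=
  if pol then form_step h else bdual (form_step h).

End Step.

Definition config_step (P : finType) (x : config P) (a : {set option P}) :
    pbool (bool * config P) :=
  let: ((bud, pol, c), (k, h)) := x in
  list_step a c (next_config a c bud pol h) (signed_step a c pol h) k.

(** The shape in which the mutual induction delivers hypotheses on the tests of [r]; lemmas on
    expressions then need only plain induction on [r]. *)
Fixpoint all_tests (P : finType) (R : form P -> Prop) (r : rexp P) : Prop :=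
  match r with
  | Letter _ => True
  | Test f => R f
  | Alt r s | Seq r s => all_tests R r /\ all_tests R s
  | Star r => all_tests R r
  end.

(* The arguments on which [first_step r next k] may call [next]. *)
Fixpoint conts (P : finType) (r : rexp P) (k : seq (rexp P)) :
    seq (seq (rexp P)) :=
  match r with
  | Letter _ => [:: k]
  | Test _ => [::]
  | Alt r s => conts r k ++ conts s k
  | Seq r s => conts r (s :: k) ++ conts s k
  | Star r => conts r (Star r :: k)
  end.

Definition list_conts (P : finType) : seq (rexp P) -> seq (seq (rexp P)) :=
  fix loop k := if k is r :: k then conts r k ++ loop k else [::].

Definition list_rel (P : finType) (w : word P) :=
  fix loop (k : seq (rexp P)) (n m : nat) : Prop :=
  if k is r :: k then exists i, rel_of w r n i /\ loop k i m else m = n.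

(** One continuation per letter occurrence, whatever [k] is: this keeps the number of states
    linear. *)
Lemma size_conts (P : finType) (r : rexp P) k : size (conts r k) <= rlength r.
Proof.
elim: r k => //= [r IHr s IHs|r IHr s IHs|r IHr] k; rewrite ?size_cat.
- by rewrite ltnW // ltnS leq_add.
- by rewrite ltnW // ltnS leq_add.
- exact: leqW.
Qed.

(** Iterated derivatives produce nothing new. For [Star r], the prepended star has the very
    continuations being collected, and the repetition is absorbed. *)
Lemma conts_conts (P : finType) (r : rexp P) k k' :
  k' \in conts r k -> {subset list_conts k' <= conts r k ++ list_conts k}.
Proof.
elim: r k k' => //= [b|r IHr s IHs|r IHr s IHs|r IHr] k k'.
- by rewrite inE => /eqP-> y yk; rewrite in_cons yk orbT.
- rewrite mem_cat => /orP[/IHr|/IHs] sub y /sub; rewrite !mem_cat;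
    by case/orP=> ->; rewrite ?orbT.
- rewrite mem_cat => /orP[/IHr|/IHs] sub y /sub; rewrite /= !mem_cat.
    by case/or3P => ->; rewrite ?orbT.
  by case/orP=> ->; rewrite ?orbT.
- by move/IHr => sub y /sub; rewrite /= !mem_cat orbA orbb.
Qed.

(** A continuation consists of subexpressions of [r] followed by [k]. *)
Lemma conts_all (P : finType) (p : rexp P -> Prop) r k k' :
  (forall r s, p (Alt r s) -> p r /\ p s) ->
  (forall r s, p (Seq r s) -> p r /\ p s) ->
  (forall r, p (Star r) -> p r) ->
  p r -> {in k, forall s, p s} -> k' \in conts r k -> {in k', forall s, p s}.
Proof.
move=> pA pS pT; elim: r k k' => //= [b|r IHr s IHs|r IHr s IHs|r IHr] k k'.
- by move=> _ pk; rewrite inE => /eqP->.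
- by move=> /pA[pr ps] pk; rewrite mem_cat => /orP[/(IHr _ _ pr pk)|/(IHs _ _ ps pk)].
- move=> /pS[pr ps] pk; rewrite mem_cat => /orP[/(IHr _ _ pr)|/(IHs _ _ ps pk)] //.
  by apply=> t; rewrite inE => /orP[/eqP->|/pk].
- move=> pr pk /(IHr _ _ (pT _ pr)); apply=> t.
  by rewrite inE => /orP[/eqP->|/pk].
Qed.

(** * Correctness of the transitions *)

Lemma rel_le (P : finType) (w : word P) r n m : rel_of w r n m -> n <= m.
Proof.
elim: r n m => /= [b|f|r IHr s IHs|r IHr s IHs|r IHr] n m.
- by case=> _ ->.
- by case=> -> _.
- by case; [apply: IHr | apply: IHs].
- by case=> i [/IHr ni /IHs]; apply: leq_trans.
- by elim=> // x y z _ xy _; apply: leq_trans xy.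
Qed.

(** Empty iterations can be skipped, which is why [first_step] may let the first iteration of a star
    consume the letter. *)
Lemma star_first (P : finType) (w : word P) r n m :
  rel_of w (Star r) n m -> n < m ->
  exists i, [/\ rel_of w r n i, n < i & rel_of w (Star r) i m].
Proof.
elim=> [x y xy lt_xy|x|x y z xy IHxy yz IHyz lt_xz]; last 1 first.
- have := rel_le (xy : rel_of w (Star r) x y); rewrite leq_eqVlt => /orP[/eqP e|/IHxy].
    by rewrite e; apply: IHyz; rewrite -e.
  by case=> i [xi lt_xi iy]; exists i; split=> //; apply: rt_trans iy yz.
- by exists y; split=> //; apply: rt_refl.
- by rewrite ltnn.
Qed.

Lemma all_testsW (P : finType) (R : form P -> Prop) r :
  (forall f, subseq (subforms f) (test_subforms r) -> R f) -> all_tests R r.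
Proof.
elim: r => //= [f|r IHr s IHs|r IHr s IHs] H.
  exact: H.
all: by split; [apply: IHr | apply: IHs] => f Hf; apply: H;
  apply: subseq_trans Hf _; [apply: prefix_subseq | apply: suffix_subseq].
Qed.

Lemma all_tests_imp (P : finType) (R S : form P -> Prop) r :
  (forall f, R f -> S f) -> all_tests R r -> all_tests S r.
Proof. by move=> RS; elim: r => //= r IHr s IHs [? ?]; auto. Qed.

(** Stated with [subseq] so that both membership and size comparisons can be drawn from it. *)
Lemma subforms_subseq (P : finType) :
  (forall f g : form P, g \in subforms f -> subseq (subforms g) (subforms f)) /\
  (forall (r : rexp P) g, g \in test_subforms r ->
     subseq (subforms g) (test_subforms r)).
Proof.
have cons_cat (s1 s2 s : seq (form P)) f :
  subseq s s1 \/ subseq s s2 -> subseq s (f :: (s1 ++ s2)).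
  move=> H; apply: subseq_trans (subseq_cons _ f).
  by case: H => /subseq_trans; apply; [apply: prefix_subseq | apply: suffix_subseq].
have cat (s1 s2 s : seq (form P)) :
  subseq s s1 \/ subseq s s2 -> subseq s (s1 ++ s2).
  by case=> /subseq_trans; apply; [apply: prefix_subseq | apply: suffix_subseq].
apply: (@form_rexp_mutind P
  (fun f => forall g, g \in subforms f -> subseq (subforms g) (subforms f))
  (fun r => forall g, g \in test_subforms r ->
     subseq (subforms g) (test_subforms r)))
  => // [q|q|f1 IH1 f2 IH2|f1 IH1 f2 IH2|f1 IH1 f2 IH2|f1 IH1 f2 IH2
        |f1 IH1 f2 IH2|f1 IH1 f2 IH2|f1 IH1 f2 IH2|f1 IH1 f2 IH2] g Hg.
all: rewrite /= ?inE ?mem_cat in Hg; try by move/eqP: Hg => ->.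
all: try by case/or3P: Hg => [/eqP->|/IH1|/IH2] // H; apply: cons_cat; auto.
all: by case/orP: Hg => [/IH1|/IH2] H; apply: cat; auto.
Qed.

(** * Where the transitions can lead *)

Section StepBall.

Variables (P : finType) (a : {set option P}) (c : option bool).
Variable Y : bool * config P -> Prop.

Lemma null_ball r :
  all_tests (fun f => ball Y (form_step a c f)) r -> ball Y (null_step a c r).
Proof. by elim: r => //= r IHr s IHs; intuition. Qed.

Lemma first_ball next r k :
  all_tests (fun f => ball Y (form_step a c f)) r ->
  {in conts r k, forall k', ball Y (next k')} ->
  ball Y (first_step a c r next k).
Proof.
elim: r k => //= [b|r IHr s IHs|r IHr s IHs|r IHr] k.
- by move=> _ H; case: ifP => // _; apply: H; rewrite mem_head.
- by case=> Hr Hs H; split; [apply: IHr | apply: IHs] => // k' Hk';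
    apply: H; rewrite mem_cat Hk' ?orbT.
- by case=> Hr Hs H; split; last split;
    [apply: IHr | apply: null_ball | apply: IHs] => // k' Hk';
    apply: H; rewrite mem_cat Hk' ?orbT.
- exact: IHr.
Qed.

Lemma list_ball next e k :
  {in k, forall r, all_tests (fun f => ball Y (form_step a c f)) r} ->
  {in list_conts k, forall k', ball Y (next k')} -> ball Y e ->
  ball Y (list_step a c next e k).
Proof.
move=> + + He; elim: k => //= r k IHk Hk Hn.
have Hr := Hk r (mem_head _ _); split; last split.
- by apply: first_ball => // k' Hk'; apply: Hn; rewrite mem_cat Hk'.
- exact: null_ball.
- by apply: IHk => [s sk|k' Hk']; [apply: Hk | apply: Hn];
    rewrite ?in_cons ?mem_cat ?sk ?Hk' orbT.
Qed.

Lemma next_ball bud pol h k :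
  (forall b, Y (true, ((b, pol, Some (None \in a)), (k, h)))) ->
  ball Y (next_config a c bud pol h k).
Proof. by rewrite /next_config; case: ifP => //=. Qed.

End StepBall.

Definition head_conts (P : finType) (f : form P) : seq (seq (rexp P) * form P) :=
  match f with
  | Dia r g | Box r g | DiaCp r g | BoxCp r g => [seq (k, g) | k <- conts r [::]]
  | _ => [::]
  end.

Definition conts_of (P : finType) (s : seq (form P)) : seq (seq (rexp P) * form P) :=
  flatten [seq head_conts f | f <- s].

Lemma conts_ofP (P : finType) (s : seq (form P)) y :
  reflect (exists2 f, f \in s & y \in head_conts f) (y \in conts_of s).
Proof. exact: flatten_mapP. Qed.

(** Each modality pays for its own expression with the summand that [fsize] reserves for it. *)
Lemma size_conts_of (P : finType) (s : seq (form P)) :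
  size (conts_of s) <= \sum_(f <- s) head_rlength f.
Proof.
elim: s => [|f s IHs]; rewrite ?big_nil // big_cons size_cat leq_add //.
by case: f => //= *; rewrite size_map size_conts.
Qed.

Definition step_inv (P : finType) (a : {set option P}) (s : seq (form P))
    (x : bool * config P) : Prop :=
  x.2.1.2 = Some (None \in a) /\ x.2.2 \in conts_of s.

Lemma form_step_ball (P : finType) (a : {set option P}) (c : option bool) f s :
  {subset subforms f <= s} ->
  ball (step_inv a s) (form_step a c f).
Proof.
move: f s.
pose ok (s : seq (form P)) f :=
  ball (step_inv a s) (form_step a c f).
(* Uniform treatment of the four modalities: up to conversion each is [list_step] on [[:: r]],
   dualized for boxes. *)
have modal bud pol h r f b s : head_conts f = [seq (k, h) | k <- conts r [::]] ->
    subforms f = f :: test_subforms r ++ subforms h ->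
    (forall s, {subset test_subforms r <= s} -> all_tests (ok s) r) ->
    {subset subforms f <= s} ->
    ball (step_inv a s) b ->
  ball (step_inv a s)
   (list_step a c (next_config a c bud pol h) b [:: r]).
  move=> hf sf Hr sub Hb; apply: list_ball => //.
    move=> r'; rewrite inE => /eqP->; apply: Hr => t Ht; apply: sub.
    by rewrite sf inE mem_cat Ht orbT.
  rewrite /= cats0 => k Hk; apply: next_ball => b' /=; split=> //; apply/conts_ofP.
  exists f; first by apply: sub; rewrite sf mem_head.
  by rewrite hf; apply: (map_f (fun k => (k, h))).
suff [] : (forall f s, {subset subforms f <= s} -> ok s f) /\
  (forall r s, {subset test_subforms r <= s} -> all_tests (ok s) r) by [].
have dualok s b : ball (step_inv a s) b ->
  ball (step_inv a s) (bdual b).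
  by move=> H; apply/ball_dual.
have catl (s1 s2 s : seq (form P)) : {subset s1 ++ s2 <= s} -> {subset s1 <= s}.
  by move=> H x Hx; apply: H; rewrite mem_cat Hx.
have catr (s1 s2 s : seq (form P)) : {subset s1 ++ s2 <= s} -> {subset s2 <= s}.
  by move=> H x Hx; apply: H; rewrite mem_cat Hx orbT.
have tl f (s1 s : seq (form P)) : {subset f :: s1 <= s} -> {subset s1 <= s}.
  by move=> H x Hx; apply: H; rewrite in_cons Hx orbT.
apply: (@form_rexp_mutind P (fun f => forall s, {subset subforms f <= s} -> ok s f)
  (fun r => forall s, {subset test_subforms r <= s} -> all_tests (ok s) r)).
- by move=> q s _; rewrite /ok /=; case: ifP.
- by move=> q s _; rewrite /ok /=; case: ifP.
- by move=> f IHf g IHg s /tl sub; split;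
    [apply: IHf; apply: catl sub | apply: IHg; apply: catr sub].
- by move=> f IHf g IHg s /tl sub; split;
    [apply: IHf; apply: catl sub | apply: IHg; apply: catr sub].
- move=> r IHr g IHg s sub; apply: (modal None true g r (Dia r g)) => //.
  by apply: IHg; apply: catr (tl _ _ _ sub).
- move=> r IHr g IHg s sub; apply: (dualok).
  apply: (modal None false g r (Box r g)) => //.
  by apply: dualok; apply: IHg; apply: catr (tl _ _ _ sub).
- move=> r IHr g IHg s sub; apply: (modal (Some true) true g r (DiaCp r g)) => //.
  by apply: IHg; apply: catr (tl _ _ _ sub).
- move=> r IHr g IHg s sub; apply: (dualok).
  apply: (modal (Some true) false g r (BoxCp r g)) => //.
  by apply: dualok; apply: IHg; apply: catr (tl _ _ _ sub).
- by [].
- by [].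
- by move=> r IHr t IHt s sub; split;
    [apply: IHr; apply: catl sub | apply: IHt; apply: catr sub].
- by move=> r IHr t IHt s sub; split;
    [apply: IHr; apply: catl sub | apply: IHt; apply: catr sub].
- by [].
Qed.

(** The successor puts a configuration strictly above those opened by its tests and its body. *)
Definition level (P : finType) (x : config P) : nat :=
  (foldr maxn (size (subforms x.2.2)) [seq size (test_subforms r) | r <- x.2.1]).+1.

Lemma levelP (P : finType) (x : config P) d :
  reflect ({in x.2.1, forall r, size (test_subforms r) <= d} /\
           size (subforms x.2.2) <= d) (level x <= d.+1).
Proof.
case: x => t [k h]; rewrite /level ltnS /=.
elim: k => [|r k IHk] /=; first by apply: (iffP idP) => [|[]].
rewrite geq_max; apply: (iffP andP) => [[Hr /IHk[Hk Hh]]|[Hk Hh]]; split=> //.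
- by move=> s; rewrite inE => /orP[/eqP->|/Hk].
- by apply: Hk; rewrite mem_head.
- by apply/IHk; split=> // s sk; apply: Hk; rewrite in_cons sk orbT.
Qed.

Lemma size_tests_conts (P : finType) (r : rexp P) k k' d :
  size (test_subforms r) <= d ->
  {in k, forall s, size (test_subforms s) <= d} -> k' \in conts r k ->
  {in k', forall s, size (test_subforms s) <= d}.
Proof.
apply: (@conts_all P (fun r => size (test_subforms r) <= d)) => //= {}r s;
by rewrite size_cat => H; split; apply: leq_trans H; rewrite ?leq_addr ?leq_addl.
Qed.

Lemma size_tests_list_conts (P : finType) (k : seq (rexp P)) k' d :
  {in k, forall s, size (test_subforms s) <= d} -> k' \in list_conts k ->
  {in k', forall s, size (test_subforms s) <= d}.
Proof.
elim: k => //= r k IHk Hk.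
have {}IHk := IHk (fun s sk => Hk s (mem_behead (s := r :: k) sk)).
rewrite mem_cat => /orP[|/IHk] //; apply: size_tests_conts.
  by apply: Hk; rewrite mem_head.
by move=> s sk; apply: Hk; rewrite in_cons sk orbT.
Qed.

(** For a modality [g] in [f], the occurrence of [g] itself in [subforms g] pays for the successor
    in [level]. *)
Lemma form_step_level (P : finType) (a : {set option P}) (c : option bool) f :
  ball (fun x => level x.2 <= size (subforms f)) (form_step a c f).
Proof.
apply: ball_imp (form_step_ball a c (s := subforms f) (fun _ H => H)).
case=> b [t [k h]] [_ /conts_ofP[g gf kg]].
have /size_subseq := (subforms_subseq P).1 _ _ gf; apply: leq_trans.
have modal r : subforms g = g :: test_subforms r ++ subforms h -> k \in conts r [::] ->
   level (t, (k, h)) <= size (subforms g).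
  move=> -> Hk; rewrite /= size_cat; apply/levelP => /=; split; last exact: leq_addl.
  by apply: size_tests_conts Hk => //; apply: leq_addr.
by case: g gf modal kg => //= r g _ modal /mapP[k' Hk' [ek eh]];
  apply: (modal r); rewrite ?ek ?eh.
Qed.

(** * Transitions against the matching relation *)

Section StepCorrect.

Variables (P : finType) (w : word P) (n : nat) (c : option bool).
Variable X : bool * config P -> Prop.

Lemma null_complete r :
  all_tests (fun f => sat w f n -> bsat X (form_step (w n) c f)) r ->
  rel_of w r n n -> bsat X (null_step (w n) c r).
Proof.
elim: r => //= [b|f|r IHr s IHs|r IHr s IHs].
- by move=> _ [_ /n_Sn].
- by move=> H [_ /H].
- by case=> [/IHr Hr /IHs Hs] [/Hr|/Hs]; [left|right].
- case=> [/IHr Hr /IHs Hs] [i [ni jn]].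
  have e : i = n by apply/eqP; rewrite eqn_leq (rel_le ni) (rel_le jn).
  by rewrite e in ni jn; split; auto.
Qed.

Lemma null_sound r :
  all_tests (fun f => bsat X (form_step (w n) c f) -> sat w f n) r ->
  bsat X (null_step (w n) c r) -> rel_of w r n n.
Proof.
elim: r => //= [f|r IHr s IHs|r IHr s IHs|r IHr].
- by move=> H /H.
- by case=> [/IHr Hr /IHs Hs] [/Hr|/Hs]; [left|right].
- by case=> [/IHr Hr /IHs Hs] [/Hr ? /Hs ?]; exists n.
- by move=> _ _; apply: rt_refl.
Qed.

(** Induction on [r] locates the letter that is consumed at [n]; whatever precedes it in a sequence
    matches the empty factor. *)
Lemma first_complete next r k m M :
  all_tests (fun f => sat w f n -> bsat X (form_step (w n) c f)) r ->
  (forall k', list_rel w k' n.+1 M -> bsat X (next k')) ->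
  rel_of w r n m -> n < m -> list_rel w k m M ->
  bsat X (first_step (w n) c r next k).
Proof.
move=> + Hn; elim: r k m => [b|f|r IHr s IHs|r IHr s IHs|r IHr] k m /=.
- by move=> _ [-> ->] _; apply: Hn.
- by move=> _ [->]; rewrite ltnn.
- by case=> [Hr Hs] [rm|sm] lt_nm km; [left; apply: IHr km|right; apply: IHs km].
- case=> [Hr Hs] [i [ri sm]] lt_nm km.
  have := rel_le ri; rewrite leq_eqVlt => /orP[/eqP e|lt_ni].
    right; split; first by apply: null_complete; rewrite // {2}e.
    by apply: IHs km; rewrite // e.
  by left; apply: IHr ri lt_ni _ => //=; exists m.
- move=> Hr rm lt_nm km; have [i [ri lt_ni im]] := star_first rm lt_nm.
  by apply: IHr ri lt_ni _ => //; exists m.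
Qed.

(** [Z] stands for the conditions on the end point that matching does not see: budget and body. *)
Lemma first_sound next r k (Z : nat -> Prop) :
  all_tests (fun f => bsat X (form_step (w n) c f) -> sat w f n) r ->
  (forall k', bsat X (next k') -> exists M, list_rel w k' n.+1 M /\ Z M) ->
  bsat X (first_step (w n) c r next k) ->
  exists m M, [/\ rel_of w r n m, list_rel w k m M & Z M].
Proof.
move=> + Hn; elim: r k => [b|f|r IHr s IHs|r IHr s IHs|r IHr] k //=.
- by case: ifP => // ab _ /Hn[M [H ?]]; exists n.+1, M.
- case=> [Hr Hs] [/(IHr _ Hr)|/(IHs _ Hs)] [m [M [H ? ?]]]; exists m, M; split=> //.
    by left.
  by right.
- case=> [Hr Hs] [/(IHr _ Hr)|[/(null_sound Hr) nr /(IHs _ Hs)]].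
    by case=> i [M [ri [m [sm km]] ZM]]; exists m, M; split=> //; exists i.
  by case=> m [M [H ? ?]]; exists m, M; split=> //; exists n.
- move=> Hr /(IHr _ Hr)[i [M [ri [m [sm km]] ZM]]]; exists m, M; split=> //.
  by apply: rt_trans sm; apply: rt_step.
Qed.

Lemma list_complete next e k M :
  {in k, forall r, all_tests (fun f => sat w f n -> bsat X (form_step (w n) c f)) r} ->
  (forall k', list_rel w k' n.+1 M -> bsat X (next k')) ->
  (M = n -> bsat X e) ->
  list_rel w k n M -> bsat X (list_step (w n) c next e k).
Proof.
move=> + Hn He; elim: k => [|r k IHk] /= Hk; first exact: He.
case=> i [ri kM]; have := rel_le ri; rewrite leq_eqVlt => /orP[/eqP ni|lt_ni].
  right; split.
    by apply: null_complete; [apply: Hk; rewrite mem_head | rewrite {2}ni].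
  by apply: IHk => [s sk|]; [apply: Hk; rewrite in_cons sk orbT | rewrite ni].
by left; apply: first_complete ri lt_ni kM => //; apply: Hk; rewrite mem_head.
Qed.

Lemma list_sound next e k (Z : nat -> Prop) :
  {in k, forall r, all_tests (fun f => bsat X (form_step (w n) c f) -> sat w f n) r} ->
  (forall k', bsat X (next k') -> exists M, list_rel w k' n.+1 M /\ Z M) ->
  (bsat X e -> Z n) ->
  bsat X (list_step (w n) c next e k) -> exists M, list_rel w k n M /\ Z M.
Proof.
move=> + Hn He; elim: k => [|r k IHk] /= Hk; first by exists n; split; auto.
have Hr := Hk r (mem_head _ _).
case=> [/(first_sound Hr Hn)[m [M [rm km ZM]]]|[/(null_sound Hr) nr]].
  by exists M; split=> //; exists m.
case/IHk => [s sk|M [kM ZM]]; first by apply: Hk; rewrite in_cons sk orbT.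
by exists M; split=> //; exists n.
Qed.

End StepCorrect.

Lemma list_rel_le (P : finType) (w : word P) k n m : list_rel w k n m -> n <= m.
Proof.
by elim: k n => [n -> //|r k IHk n [i [/rel_le ni /IHk]]]; apply: leq_trans.
Qed.

(** * Changepoint budgets and witnesses *)

Definition prev (P : finType) (w : word P) (n : nat) : option bool :=
  if n is m.+1 then Some (None \in w m) else None.

Lemma changepoint_prev (P : finType) (w : word P) n :
  changepoint w n = (prev w n != Some (None \in w n)).
Proof. by case: n. Qed.

Definition within (P : finType) (w : word P) (bud : option bool) (n j : nat) : bool :=
  if bud is Some b then count (changepoint w) (iota n j) <= b else true.

(** Unfolds the budget by one letter exactly as [next_config] does. *)
Lemma withinS (P : finType) (w : word P) bud n j :
  within w bud n j.+1 = ~~ (changepoint w n && (bud == Some false)) &&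
    within w (omap (fun b => b && ~~ changepoint w n) bud) n.+1 j.
Proof. by case: bud => [[]|] /=; case: (changepoint w n) => //=; rewrite ?andbF. Qed.

Definition polsat (P : finType) (w : word P) (pol : bool) (h : form P) (n : nat) : Prop :=
  if pol then sat w h n else ~ sat w h n.

Definition witness (P : finType) (w : word P) (x : config P) (n j : nat) : Prop :=
  let: ((bud, pol, c), (k, h)) := x in
  [/\ list_rel w k n (n + j), within w bud n j & polsat w pol h (n + j)].

Notation holds w n := (signed (@witness _ w) n).

Section ConfigStep.

Variables (P : finType) (w : word P) (n : nat).
Variables (bud : option bool) (pol : bool) (h : form P).

Lemma next_complete X k j :
  (forall bud', witness w ((bud', pol, prev w n.+1), (k, h)) n.+1 j ->
     X (true, ((bud', pol, prev w n.+1), (k, h)))) ->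
  list_rel w k n.+1 (n + j.+1) -> within w bud n j.+1 -> polsat w pol h (n + j.+1) ->
  bsat X (next_config (w n) (prev w n) bud pol h k).
Proof.
rewrite withinS changepoint_prev addnS -addSn => HX kM + hM.
by rewrite /next_config; case: ifP => //= _ Hw; apply: HX.
Qed.

Lemma next_sound k :
  bsat (holds w n.+1) (next_config (w n) (prev w n) bud pol h k) ->
  exists M, list_rel w k n.+1 M /\ (within w bud n (M - n) /\ polsat w pol h M).
Proof.
rewrite /next_config; case: ifP => // ok /= [j [kM Hw hM]].
exists (n.+1 + j); split=> //; split=> //.
by rewrite addSn -addnS addKn withinS changepoint_prev ok.
Qed.

Lemma signed_step_sat f :
  sat w f n <-> bsat (holds w n.+1) (form_step (w n) (prev w n) f) ->
  polsat w pol f n <-> bsat (holds w n.+1) (signed_step (w n) (prev w n) pol f).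
Proof.
rewrite /polsat /signed_step; case: pol => // ->.
by rewrite bsat_dual //; apply: signedN.
Qed.

Lemma config_step_sat k :
  let sat_step f :=
    sat w f n <-> bsat (holds w n.+1) (form_step (w n) (prev w n) f) in
  {in k, forall r, all_tests sat_step r} -> sat_step h ->
  (exists j, witness w ((bud, pol, prev w n), (k, h)) n j) <->
  bsat (holds w n.+1) (config_step ((bud, pol, prev w n), (k, h)) (w n)).
Proof.
move=> sat_step Hk Hh; split=> [[j [kM Hw hM]]|].
  apply: list_complete kM => [r /Hk|k' k'M|e]; first by apply: all_tests_imp => f [].
  (* Consuming a letter needs [j > 0]: with [j = 0] the list would match backwards from [n.+1] to
     [n]. *)
  - case: j Hw hM k'M => [|j] Hw hM k'M.
      by have := list_rel_le k'M; rewrite addn0 ltnn.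
    by apply: next_complete k'M Hw hM => bud' Hj; exists j.
  - by apply/signed_step_sat; rewrite // e in hM.
move/list_sound => /(_ (fun M => within w bud n (M - n) /\ polsat w pol h M)).
case=> [||| M [kM [Hw hM]]].
- by move=> r /Hk; apply: all_tests_imp => f [].
- exact: next_sound.
- by move/signed_step_sat => /(_ Hh) ?; rewrite subnn; split=> //; case: (bud).
- by exists (M - n); rewrite /witness subnKC ?(list_rel_le kM).
Qed.

End ConfigStep.

(** Successors are interpreted by the semantics at [n.+1], so structural induction suffices, with no
    induction on positions or runs. *)
Lemma form_step_sat (P : finType) (w : word P) f n :
  sat w f n <-> bsat (holds w n.+1) (form_step (w n) (prev w n) f).
Proof.
pose ok f := forall n, sat w f n <-> bsat (holds w n.+1) (form_step (w n) (prev w n) f).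
have modal bud pol r h m : all_tests ok r -> ok h ->
    (exists j, [/\ rel_of w r m (m + j), within w bud m j & polsat w pol h (m + j)]) <->
    bsat (holds w m.+1) (config_step ((bud, pol, prev w m), ([:: r], h)) (w m)).
  move=> Hr Hh; rewrite -config_step_sat //; last first.
    by move=> r'; rewrite inE => /eqP->; apply: all_tests_imp Hr => f'.
  split=> -[j [rj ? ?]]; exists j; split=> //; first by exists (m + j).
  by case: rj => i [ri /= ->].
have dual m b : bsat (holds w m.+1) (bdual b) <-> ~ bsat (holds w m.+1) b.
  by apply: bsat_dual; apply: signedN.
move: f n; suff [] : (forall f, ok f) /\ (forall r, all_tests ok r) by [].
apply: (@form_rexp_mutind P ok (all_tests ok)).
- by move=> q n; rewrite /=; case: (q \in w n).
- by move=> q n; rewrite /=; case: (q \in w n).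
- by move=> f IHf g IHg n; rewrite /= IHf IHg.
- by move=> f IHf g IHg n; rewrite /= IHf IHg.
- move=> r IHr g IHg n; rewrite -(modal None true r g n IHr IHg).
  by split=> -[j]; [case=> ? ? | case=> ? _ ?]; exists j.
- move=> r IHr g IHg n.
  (* The transition of a box is convertible to the dual of [config_step] with polarity [false]. *)
  apply: iff_trans (iff_sym (dual n
    (config_step ((None, false, prev w n), ([:: r], g)) (w n)))).
  rewrite -(modal None false r g n IHr IHg); split=> [H [j [/H]] //|H j rj].
  by apply: NNPP => nj; apply: H; exists j.
- move=> r IHr g IHg n; rewrite -(modal (Some true) true r g n IHr IHg).
  by split=> -[j [? ? ?]]; exists j.
- move=> r IHr g IHg n.
  apply: iff_trans (iff_sym (dual n
    (config_step ((Some true, false, prev w n), ([:: r], g)) (w n)))).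
  rewrite -(modal (Some true) false r g n IHr IHg).
  split=> [H [j [/H{}H /H]] //|H j rj cpj].
  by apply: NNPP => nj; apply: H; exists j.
- by [].
- by [].
- by [].
- by [].
- by [].
Qed.

(** * Descent, closure and correctness for configurations *)

Lemma config_step_level (P : finType) (x : config P) (a : {set option P}) :
  ball (fun s : bool * config P => level s.2 < level x \/ s.1 /\ level s.2 <= level x)
    (config_step x a).
Proof.
case: x => [[[bud pol] c] [k h]].
pose d := (level ((bud, pol, c), (k, h))).-1.
have [Hk Hh] : {in k, forall r, size (test_subforms r) <= d} /\ size (subforms h) <= d.
  exact: (elimT (levelP ((bud, pol, c), (k, h)) d)).
rewrite -[level (_, (k, h))]/(d.+1).
have low f : size (subforms f) <= d ->
  ball (fun s : bool * config P => level s.2 < d.+1) (form_step a c f).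
  move=> fd; apply: ball_imp (form_step_level a c f) => s; rewrite ltnS.
  by move/leq_trans; apply.
(* Successors from tests and body drop in level; those reached by consuming a letter stay positive
   and do not rise. *)
apply: list_ball => [r /Hk rd|k' Hk'|].
- apply: all_testsW => f /size_subseq/leq_trans/(_ rd)/low.
  by apply: ball_imp => s; left.
- apply: next_ball => b; right; split=> //; apply/levelP; split=> //=.
  exact: size_tests_list_conts Hk'.
- have {}Hh := low _ Hh; rewrite /signed_step.
  by case: (pol); rewrite ?ball_dual; apply: ball_imp Hh => s; left.
Qed.

Lemma list_conts_sub (P : finType) (r : rexp P) k :
  k \in conts r [::] -> {subset list_conts k <= conts r [::]}.
Proof. by move=> /conts_conts; rewrite cats0. Qed.

(** The initial pair has no continuations, and those of any other pair stay within its modality;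
    tests and body only open modalities of [f]. *)
Lemma config_step_ball (P : finType) (f : form P) (x : config P) (a : {set option P}) :
  x.2 \in ([::], f) :: conts_of (subforms f) ->
  ball (step_inv a (subforms f)) (config_step x a).
Proof.
case: x => [[[bud pol] c] [k h]].
have low s (g : form P) : {subset subforms g <= subforms f} ->
    ball (step_inv a (subforms f)) (signed_step a c s g).
  move=> /form_step_ball-/(_ a c) Hg; rewrite /signed_step.
  by case: s => //; rewrite ball_dual.
rewrite in_cons => /orP[/eqP[-> ->]|/conts_ofP[g gf kg]].
  by apply: list_ball => //; apply: low.
have sub := mem_subseq ((subforms_subseq P).1 _ _ gf).
have modal r : head_conts g = [seq (k', h) | k' <- conts r [::]] ->
    subforms g = g :: test_subforms r ++ subforms h -> k \in conts r [::] ->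
    ball (step_inv a (subforms f)) (config_step ((bud, pol, c), (k, h)) a).
  move=> hg sg kr; apply: list_ball.
  - have Hk : {in k, forall r', {subset test_subforms r' <= subforms f}}.
      apply: (@conts_all P (fun r' => {subset test_subforms r' <= subforms f})) kr => //.
      + by move=> r1 r2 H; split=> t Ht; apply: H; rewrite /= mem_cat Ht ?orbT.
      + by move=> r1 r2 H; split=> t Ht; apply: H; rewrite /= mem_cat Ht ?orbT.
      + by move=> t Ht; apply: sub; rewrite sg in_cons mem_cat Ht orbT.
    move=> r' /Hk Hr'; apply: all_testsW => t /mem_subseq Ht.
    by apply: (low true) => y /Ht /Hr'.
  - move=> k' /(list_conts_sub kr) Hk'; apply: next_ball => b; split=> //=.
    by apply/conts_ofP; exists g; rewrite // hg; apply: (map_f (fun k => (k, h))).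
  - by apply: low => t Ht; apply: sub; rewrite sg in_cons mem_cat Ht !orbT.
by case: g gf kg modal sub => //= r g _ /mapP[k' Hk' [ek eh]] modal _;
  apply: (modal r); rewrite ?ek ?eh.
Qed.

(** Follows the given witness: a consumed letter shortens it by one, and all other successors come
    from tests or the body, at a lower level. *)
Lemma config_step_complete (P : finType) (w : word P) (x : config P) n j :
  x.1.2 = prev w n -> witness w x n j ->
  bsat (fun s : bool * config P => holds w n.+1 s /\
          (level s.2 < level x \/ s.1 /\ exists2 i, i < j & witness w s.2 n.+1 i))
    (config_step x (w n)).
Proof.
case: x => [[[bud pol] c] [k h]] /= -> [kM Hw hM].
set X := fun s => _.
pose d := (level ((bud, pol, prev w n), (k, h))).-1.
have [Hk Hh] : {in k, forall r, size (test_subforms r) <= d} /\ size (subforms h) <= d.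
  exact: (elimT (levelP ((bud, pol, prev w n), (k, h)) d)).
have low b f : size (subforms f) <= d -> polsat w b f n ->
    bsat X (signed_step (w n) (prev w n) b f).
  move=> fd /(signed_step_sat b (form_step_sat w f n)) Hf.
  have Hl : ball (fun s : bool * config P => level s.2 <= d)
      (signed_step (w n) (prev w n) b f).
    by rewrite /signed_step; case: (b); rewrite ?ball_dual;
      apply: ball_imp (form_step_level _ _ f) => s /leq_trans; apply.
  by apply: bsat_imp (bsat_ball Hl Hf) => s [? ?]; split=> //; left.
apply: list_complete kM => [r /Hk rd|k' k'M|e].
- by apply: all_testsW => f /size_subseq/leq_trans/(_ rd) /(low true).
- case: j Hw hM k'M @X low => [|j] Hw hM k'M X low.
    by have := list_rel_le k'M; rewrite addn0 ltnn.
  apply: next_complete k'M Hw hM => bud' Hj; split; first by exists j.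
  by right; split=> //; exists j.
- by apply: low => //; rewrite e in hM.
Qed.

Lemma config_step_sound (P : finType) (w : word P) (x : config P) n :
  x.1.2 = prev w n -> bsat (holds w n.+1) (config_step x (w n)) ->
  exists j, witness w x n j.
Proof.
case: x => [[[bud pol] c] [k h]] /= -> H; apply/config_step_sat => //.
  by move=> r _; apply: all_testsW => f _; apply: form_step_sat.
exact: form_step_sat.
Qed.

Theorem theorem2 :
  exists C : nat, forall (P : finType) (phi : form P),
    exists A : aba {set option P},
      #|state A| <= C * fsize phi /\
      (forall w : word P, lang A w <-> models w phi).
Proof.
(* 38 >= 2 * 18 + 2: there are 3 * 2 * 3 = 18 tags, 2 signs, and the initial
   state is listed twice. *)
exists 38 => P phi.
pose L0 := ([::], phi) :: conts_of (subforms phi).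
pose tags := enum {: option bool * bool * option bool}.
(* With nothing left to match, the transition is that of [phi] itself; the last [None] marks
   position 0. *)
pose x0 : config P := ((None, true, None), ([::], phi)).
pose L : seq (config P) := [seq (t, y) | t <- tags, y <- L0].
have memL (x : config P) : (x \in x0 :: L) = (x.2 \in L0).
  case: x => t y; rewrite in_cons.
  have -> : ((t, y) \in L) = (y \in L0).
    apply/allpairsP/idP => [[[t' y'] [_ Hy' [_ ->]]] //|Hy].
    by exists (t, y); split; rewrite // mem_enum.
  apply: orb_idl => /eqP[_ ->]; exact: mem_head.
have [||A [sizeA langA]] := @signed_lang_seq _ _ x0 L (@config_step P) (@level P).
- move=> x a; rewrite memL => /(config_step_ball a).
  by apply: ball_imp => s [_ Hs]; rewrite memL in_cons Hs orbT.
- exact: config_step_level.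
exists A; split.
  (* The extra pair for [phi] is paid by the set of subformulas, which is nonempty. *)
  have sizeL0 : (size (conts_of (subforms phi))).+1 <= fsize phi.
    rewrite -add1n leq_add ?size_conts_of // -has_predT.
    by apply/hasP; exists phi => //; rewrite mem_undup; case: (phi) => *; apply: mem_head.
  rewrite sizeA size_allpairs -cardE !card_prod !card_option card_bool.
  have -> : size L0 = (size (conts_of (subforms phi))).+1 by [].
  move: (size (conts_of _)) sizeL0 => m; move: (fsize phi) => F Hm.
  by rewrite -[2 * _]/(2 * (18 * m.+1).+1); lia.
move=> w; rewrite (langA w (fun x n => x.1.2 = prev w n) (@witness P w)) //.
(* The empty list forces witness length 0. *)
- split=> [[j [/= e _]]|H]; first by rewrite e.
  by exists 0; split.
- move=> x n; rewrite memL => /(config_step_ball (w n)) H _.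
  by apply: ball_imp H => s [].
- exact: config_step_complete.
- exact: config_step_sound.
Qed.
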